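(* All irreducible 2-dimensional representations of $B_3$, up to isomorphism and up to tensor with 1-dimensional representations, are in the form (i) $$\sigma_1 \mapsto \begin{bmatrix} -z & 0 \\ 0 & 1 \end{bmatrix}, \qquad \sigma_2 \mapsto \begin{bmatrix} \frac{1}{z+1} & f \\ g & -\frac{z^2}{z+1} \end{bmatrix},$$ where $fg = \dfrac{z(z^2+z+1)}{(z+1)^2}$, $z \neq 0, -1$ and $z^2+z+1 \neq 0$, or in the form (ii) $$\sigma_1 \mapsto \begin{bmatrix} 1 & z \\ 0 & 1 \end{bmatrix}, \qquad \sigma_2 \mapsto \begin{bmatrix} e & z(e-1)^2 \\ -\frac{1}{z} & 2-e \end{bmatrix},$$ where $z \neq 0$. Here $z, e, f, g$ are complex numbers.
   Context: The braid group $B_3$ is the group with generators $\sigma_1, \sigma_2$ and the single relation $\sigma_1\sigma_2\sigma_1 = \sigma_2\sigma_1\sigma_2$. A $k$-dimensional complex representation of $B_3$ is a group homomorphism $B_3 \to GL_k(\mathbb{C})$, where $GL_k(\mathbb{C})$ is the group of invertible complex $k \times k$ matrices; all representations here are complex. Two representations are isomorphic if they are conjugate by a fixed invertible matrix. A representation is called irreducible if it is not isomorphic to a direct sum of two lower dimensional representations; all 1-dimensional representations are irreducible by definition. The 1-dimensional representations of $B_3$ are exactly $\xi(w): \sigma_1, \sigma_2 \mapsto w$ for $w \in \mathbb{C}^*$.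
   Formalization: ''Irreducible'' is taken as having no nonzero proper invariant subspace, not merely as not being a direct sum: under the latter, sending both generators to [1 1; 0 1] is a counterexample, and no reducible representation is ever of form (i) or (ii) up to isomorphism and twist. *)

(* Defs.v *)
From HB Require Import structures.
From mathcomp Require Import all_boot all_order all_algebra.
From mathcomp Require Import generic_quotient monoid.
From mathcomp Require Import boolp reals complex.

Set Implicit Arguments.
Unset Strict Implicit.
Unset Printing Implicit Defensive.

Import GRing.Theory.

Local Open Scope quotient_scope.

(* A letter is a generator, [false] for sigma_1 and [true] for sigma_2, with a
   sign, [true] for the inverse of the generator. *)
Definition braid_letter : Type := (bool * bool)%type.
Definition braid_word : Type := seq braid_letter.

Definition inv_letter (a : braid_letter) : braid_letter := (a.1, ~~ a.2).
Definition inv_word (u : braid_word) : braid_word := rev (map inv_letter u).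

Definition sigma1_letter : braid_letter := (false, false).
Definition sigma2_letter : braid_letter := (true, false).

Inductive braid_cong : braid_word -> braid_word -> Prop :=
| bc_refl u : braid_cong u u
| bc_sym u v : braid_cong u v -> braid_cong v u
| bc_trans v u w : braid_cong u v -> braid_cong v w -> braid_cong u w
| bc_cat u1 u2 v1 v2 : braid_cong u1 u2 -> braid_cong v1 v2 ->
    braid_cong (u1 ++ v1) (u2 ++ v2)
| bc_cancel a : braid_cong [:: a; inv_letter a] [::]
| bc_braid : braid_cong [:: sigma1_letter; sigma2_letter; sigma1_letter]
                        [:: sigma2_letter; sigma1_letter; sigma2_letter].

Definition braid_congb : rel braid_word := fun u v => `[< braid_cong u v >].

Lemma braid_congb_refl : reflexive braid_congb.
Proof. by move=> u; apply/asboolP; apply: bc_refl. Qed.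

Lemma braid_congb_sym : symmetric braid_congb.
Proof. by move=> u v; apply: asbool_equiv_eq; split; apply: bc_sym. Qed.

Lemma braid_congb_trans : transitive braid_congb.
Proof.
by move=> v u w /asboolP uv /asboolP vw; apply/asboolP; apply: bc_trans uv vw.
Qed.

Canonical braid_congb_equiv :=
  EquivRel braid_congb braid_congb_refl braid_congb_sym braid_congb_trans.

Definition B3 : Type := {eq_quot braid_congb}.
HB.instance Definition _ := Choice.on B3.

Definition braid_class (u : braid_word) : B3 := \pi_{eq_quot braid_congb} u.

Lemma braid_classP u v : braid_class u = braid_class v <-> braid_cong u v.
Proof.
split=> [/eqP|uv]; first by rewrite /braid_class piE => /asboolP.
by apply/eqP; rewrite /braid_class piE; apply/asboolP.
Qed.

Definition braid_repr (x : B3) : braid_word :=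
  repr (x : {eq_quot braid_congb}).

Lemma braid_reprK x : braid_class (braid_repr x) = x.
Proof. exact: reprK. Qed.

Lemma inv_letterK : involutive inv_letter.
Proof. by case=> i s; rewrite /inv_letter /= negbK. Qed.

Lemma inv_wordK : involutive inv_word.
Proof. by move=> u; rewrite /inv_word map_rev revK (mapK inv_letterK). Qed.

Lemma inv_word_cat u v : inv_word (u ++ v) = inv_word v ++ inv_word u.
Proof. by rewrite /inv_word map_cat rev_cat. Qed.

Lemma braid_cong_mulV u : braid_cong (u ++ inv_word u) [::].
Proof.
elim: u => [|a u IHu]; first exact: bc_refl.
rewrite -cat1s inv_word_cat -!catA [u ++ _]catA.
apply: bc_trans (bc_cancel a); apply: (bc_cat (bc_refl [:: a])).
exact: (bc_cat IHu (bc_refl _)).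
Qed.

Lemma braid_cong_inv u v : braid_cong u v ->
  braid_cong (inv_word u) (inv_word v).
Proof.
move=> uv; apply: (@bc_trans (inv_word u ++ v ++ inv_word v)).
  apply: bc_sym; rewrite -[X in braid_cong _ X]cats0.
  exact: bc_cat (bc_refl _) (braid_cong_mulV v).
rewrite catA -[X in braid_cong _ X]cat0s; apply: bc_cat (bc_refl _).
apply: (@bc_trans (inv_word u ++ u)).
  exact: bc_cat (bc_refl _) (bc_sym uv).
by rewrite -{2}[u]inv_wordK; apply: braid_cong_mulV.
Qed.

Definition B3_one : B3 := braid_class [::].
Definition B3_mul (x y : B3) : B3 := braid_class (braid_repr x ++ braid_repr y).
Definition B3_inv (x : B3) : B3 := braid_class (inv_word (braid_repr x)).

Lemma B3_mul_class u v :
  B3_mul (braid_class u) (braid_class v) = braid_class (u ++ v).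
Proof. by apply/braid_classP/bc_cat; apply/braid_classP/braid_reprK. Qed.

Lemma B3_inv_class u : B3_inv (braid_class u) = braid_class (inv_word u).
Proof. by apply/braid_classP/braid_cong_inv/braid_classP/braid_reprK. Qed.

Lemma B3_mulA : associative B3_mul.
Proof.
move=> x y z; rewrite -(braid_reprK x) -(braid_reprK y) -(braid_reprK z).
by rewrite !B3_mul_class catA.
Qed.

Lemma B3_mul1 : left_id B3_one B3_mul.
Proof. by move=> x; rewrite -(braid_reprK x) B3_mul_class. Qed.

Lemma B3_mulr1 : right_id B3_one B3_mul.
Proof. by move=> x; rewrite -(braid_reprK x) B3_mul_class cats0. Qed.

Lemma B3_mulrV : right_inverse B3_one B3_inv B3_mul.
Proof.
move=> x; rewrite -(braid_reprK x) B3_inv_class B3_mul_class.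
exact/braid_classP/braid_cong_mulV.
Qed.

Lemma B3_mulV : left_inverse B3_one B3_inv B3_mul.
Proof.
move=> x; rewrite -(braid_reprK x) B3_inv_class B3_mul_class.
apply/braid_classP; set u := braid_repr x.
by rewrite -{2}[u]inv_wordK; apply: braid_cong_mulV.
Qed.

HB.instance Definition _ :=
  isGroup.Build B3 B3_mulA B3_mul1 B3_mulr1 B3_mulV B3_mulrV.

Lemma B3_mulE (x y : B3) : (x * y)%g = B3_mul x y. Proof. by []. Qed.
Lemma B3_invE (x : B3) : (x^-1)%g = B3_inv x. Proof. by []. Qed.

Definition sigma1 : B3 := braid_class [:: sigma1_letter].
Definition sigma2 : B3 := braid_class [:: sigma2_letter].

Lemma B3_relation : (sigma1 * sigma2 * sigma1 = sigma2 * sigma1 * sigma2)%g.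
Proof.
rewrite /sigma1 /sigma2 !B3_mulE !B3_mul_class /=.
exact/braid_classP/bc_braid.
Qed.

Section UniversalProperty.
Local Open Scope group_scope.
Variables (G : groupType) (a b : G).
Hypothesis ab_braid : a * b * a = b * a * b.

Definition letter_value (l : braid_letter) : G :=
  let c := if l.1 then b else a in if l.2 then c^-1 else c.

Definition word_value (u : braid_word) : G :=
  foldr (fun l x => letter_value l * x) 1 u.

Lemma word_value_cat u v : word_value (u ++ v) = word_value u * word_value v.
Proof. by elim: u => [|l u IHu] /=; rewrite ?mul1g // IHu mulgA. Qed.

Lemma word_value_cong u v : braid_cong u v -> word_value u = word_value v.
Proof.
elim=> {u v} //.
- by move=> v u w _ -> _ ->.
- by move=> u1 u2 v1 v2 _ eu _ ev; rewrite !word_value_cat eu ev.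
- by case=> i [] /=; rewrite /letter_value /= mulg1 ?mulVg ?mulgV.
- by rewrite /= /letter_value /= !mulg1 !mulgA.
Qed.

Definition B3_lift (x : B3) : G := word_value (braid_repr x).

Lemma B3_lift_class u : B3_lift (braid_class u) = word_value u.
Proof. by apply/word_value_cong/braid_classP/braid_reprK. Qed.

Lemma B3_lift_morph : {morph B3_lift : x y / x * y}.
Proof.
by move=> x y; rewrite B3_mulE B3_lift_class word_value_cat.
Qed.

HB.instance Definition _ := isMultiplicative.Build B3 G B3_lift B3_lift_morph.

Lemma B3_lift_sigma1 : B3_lift sigma1 = a.
Proof. by rewrite B3_lift_class /= mulg1. Qed.

Lemma B3_lift_sigma2 : B3_lift sigma2 = b.
Proof. by rewrite B3_lift_class /= mulg1. Qed.

Lemma B3_lift_exists : exists f : {multiplicative B3 -> G},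
  f sigma1 = a /\ f sigma2 = b.
Proof. by exists B3_lift; rewrite /= B3_lift_sigma1 B3_lift_sigma2. Qed.

End UniversalProperty.

Lemma multiplicative1 (G H : groupType) (f : {multiplicative G -> H}) :
  (f 1 = 1)%g.
Proof. by apply: (mulgI (f 1%g)); rewrite -gmulfM !mulg1. Qed.

Lemma multiplicativeV (G H : groupType) (f : {multiplicative G -> H}) x :
  (f x^-1 = (f x)^-1)%g.
Proof. by apply: (mulgI (f x)); rewrite -gmulfM !mulgV multiplicative1. Qed.

Lemma B3_morph_ext (G : groupType) (f h : {multiplicative B3 -> G}) :
  f sigma1 = h sigma1 -> f sigma2 = h sigma2 -> f =1 h.
Proof.
move=> e1 e2 x; rewrite -(braid_reprK x); elim: (braid_repr x) => [|l u IHu].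
  by rewrite (multiplicative1 f) (multiplicative1 h).
have -> : braid_class (l :: u) = (braid_class [:: l] * braid_class u)%g.
  by rewrite B3_mulE B3_mul_class.
rewrite !gmulfM IHu; congr (_ * _)%g; case: l => -[] [] //=.
- have -> : braid_class [:: (true, true)] = (sigma2^-1)%g.
    by rewrite B3_invE B3_inv_class.
  by rewrite !multiplicativeV e2.
- have -> : braid_class [:: (false, true)] = (sigma1^-1)%g.
    by rewrite B3_invE B3_inv_class.
  by rewrite !multiplicativeV e1.
Qed.

Local Open Scope ring_scope.

(* The library's {'GL_n[R]} requires a finite ring. *)
Record GL (F : fieldType) (k : nat) : Type :=
  MkGL { GL_mx :> 'M[F]_k; GLmxP : GL_mx \in unitmx }.

HB.instance Definition _ (F : fieldType) (k : nat) := [isSub for @GL_mx F k].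
HB.instance Definition _ (F : fieldType) (k : nat) :=
  [Choice of GL F k by <:].

Section GLGroup.
Variables (F : fieldType) (k : nat).
Implicit Types A B : GL F k.

Lemma GL_mul_unit A B : (A : 'M_k) *m B \in unitmx.
Proof. by rewrite unitmx_mul !GLmxP. Qed.

Lemma GL_inv_unit A : invmx A \in unitmx.
Proof. by rewrite unitmx_inv GLmxP. Qed.

Definition GL_one : GL F k := MkGL (unitmx1 F k).
Definition GL_mul A B : GL F k := MkGL (GL_mul_unit A B).
Definition GL_inv A : GL F k := MkGL (GL_inv_unit A).

Lemma GL_mulA : associative GL_mul.
Proof. by move=> A B C; apply: val_inj; apply: mulmxA. Qed.

Lemma GL_mul1 : left_id GL_one GL_mul.
Proof. by move=> A; apply: val_inj; apply: mul1mx. Qed.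

Lemma GL_mulr1 : right_id GL_one GL_mul.
Proof. by move=> A; apply: val_inj; apply: mulmx1. Qed.

Lemma GL_mulV : left_inverse GL_one GL_inv GL_mul.
Proof. by move=> A; apply: val_inj; apply/mulVmx/GLmxP. Qed.

Lemma GL_mulrV : right_inverse GL_one GL_inv GL_mul.
Proof. by move=> A; apply: val_inj; apply/mulmxV/GLmxP. Qed.

HB.instance Definition _ :=
  isGroup.Build (GL F k) GL_mulA GL_mul1 GL_mulr1 GL_mulV GL_mulrV.

End GLGroup.

Definition B3_rep (F : fieldType) (k : nat) : Type :=
  {multiplicative B3 -> GL F k}.

Section Representations.
Variables (F : fieldType) (k : nat).
Implicit Types (rho tau : B3_rep F k) (xi : B3_rep F 1).

Definition rep_iso rho tau : Prop :=
  exists P : GL F k, forall g : B3, rho g = (P * tau g * P^-1)%g.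

(* No nonzero proper invariant subspace.  This is strictly stronger than not
   being a direct sum: sigma1, sigma2 |-> [1 1; 0 1] is indecomposable but
   reducible, and no twist of it is conjugate to either form below.
   Matrices act on column vectors: the subspace of F^k spanned by the
   (transposed) rows of U is stable under A when U is row-stable under A^T. *)
Definition rep_irreducible rho : Prop :=
  (0 < k)%N /\
  forall U : 'M[F]_k, (forall g : B3, stablemx U (rho g : 'M[F]_k)^T) ->
    U != 0 -> row_full U.

(* The tensor product of a matrix with the 1 x 1 matrix (w) is its multiple
   by w. *)
Lemma tensor1_unit (W : GL F 1) (A : GL F k) :
  (W : 'M[F]_1) ord0 ord0 *: (A : 'M[F]_k) \in unitmx.
Proof.
by rewrite unitmxZ ?GLmxP // -det_mx11; move: (GLmxP W); rewrite unitmxE.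
Qed.

Definition tensor1_fun xi tau (g : B3) : GL F k :=
  MkGL (tensor1_unit (xi g) (tau g)).

Lemma tensor1_morph xi tau : {morph tensor1_fun xi tau : x y / (x * y)%g}.
Proof.
move=> x y; apply: val_inj; rewrite /= !gmulfM /=.
by rewrite mxE big_ord1 -scalemxAl -scalemxAr scalerA.
Qed.

HB.instance Definition _ xi tau :=
  isMultiplicative.Build B3 (GL F k) (tensor1_fun xi tau) (tensor1_morph xi tau).

Definition tensor1 xi tau : B3_rep F k := tensor1_fun xi tau.

End Representations.

Definition mx22 (F : fieldType) (a b c d : F) : 'M[F]_2 :=
  \matrix_(i < 2, j < 2)
    if i == ord0 then (if j == ord0 then a else b)
    else (if j == ord0 then c else d).

Definition form_i (F : fieldType) (tau : B3_rep F 2) : Prop :=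
  exists z f g : F,
    [/\ f * g = z * (z ^+ 2 + z + 1) / (z + 1) ^+ 2,
        z != 0 /\ z != - 1,
        z ^+ 2 + z + 1 != 0,
        tau sigma1 = mx22 (- z) 0 0 1 :> 'M[F]_2 &
        tau sigma2 = mx22 (1 / (z + 1)) f g (- (z ^+ 2 / (z + 1)))
          :> 'M[F]_2].

Definition form_ii (F : fieldType) (tau : B3_rep F 2) : Prop :=
  exists z e : F,
    [/\ z != 0,
        tau sigma1 = mx22 1 z 0 1 :> 'M[F]_2 &
        tau sigma2 = mx22 e (z * (e - 1) ^+ 2) (- (1 / z)) (2 - e)
          :> 'M[F]_2].

(* Main.v *)
(* A common eigenvector of the two generators would span an invariant line, so
   the matrices of an irreducible representation have none.  Over an
   algebraically closed field the first generator becomes upper triangular in a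
   suitable basis; after division by its second eigenvalue it is either
   diag(-z, 1) with z <> -1 or unipotent.  In both cases the off-diagonal
   entries of the second generator that would create a common eigenvector are nonzero,
   and cancelling them in the braid relation determines the other entries. *)
Require Import Defs.
From HB Require Import structures.
From mathcomp Require Import all_boot all_order all_algebra.
From mathcomp Require Import monoid reals complex ring.

Set Implicit Arguments.
Unset Strict Implicit.
Unset Printing Implicit Defensive.

Import GRing.Theory.

Local Open Scope ring_scope.

(** * Reduction of statements about [B3] and its representations to the two generators *)

Lemma B3_ind (Q : B3 -> Prop) :
  Q 1%g -> (forall x y, Q x -> Q y -> Q (x * y)%g) ->
  (forall x, Q x -> Q x^-1%g) -> Q sigma1 -> Q sigma2 -> forall x, Q x.
Proof.
move=> Q1 QM QV Qs1 Qs2 x; rewrite -(braid_reprK x).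
elim: (braid_repr x) => [|l u IHu]; first exact: Q1.
rewrite -cat1s -B3_mul_class; apply: QM IHu.
case: l => -[] []; [|exact: Qs2| |exact: Qs1].
- by move: (QV _ Qs2); rewrite B3_invE B3_inv_class.
- by move: (QV _ Qs1); rewrite B3_invE B3_inv_class.
Qed.

Section ConjugateRep.
Variables (F : fieldType) (k : nat) (P : GL F k) (rho : B3_rep F k).

Definition conj_rep_fun (g : B3) : GL F k := (P * rho g * P^-1)%g.

Lemma conj_rep_morph : {morph conj_rep_fun : x y / (x * y)%g}.
Proof. by move=> x y; rewrite /conj_rep_fun gmulfM !mulgA mulgVK. Qed.

HB.instance Definition _ :=
  isMultiplicative.Build B3 (GL F k) conj_rep_fun conj_rep_morph.

Definition conj_rep : B3_rep F k := conj_rep_fun.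

End ConjugateRep.

(** A conjugated representation is again a homomorphism, and homomorphisms from [B3] that agree on
    the generators are equal; two matrix identities therefore suffice. *)
Lemma rep_iso_gen (F : fieldType) (k : nat) (rho tau : B3_rep F k)
    (P : GL F k) :
  rho sigma1 = (P * tau sigma1 * P^-1)%g ->
  rho sigma2 = (P * tau sigma2 * P^-1)%g -> rep_iso rho tau.
Proof.
by move=> e1 e2; exists P; apply: (@B3_morph_ext _ rho (conj_rep P tau)).
Qed.

Lemma GL1_unit (F : fieldType) (w : F) : w != 0 -> (w%:M : 'M[F]_1) \in unitmx.
Proof. by rewrite unitmxE det_scalar1 unitfE. Qed.

Lemma rep1_exists (F : fieldType) (w : F) : w != 0 ->
  exists xi : B3_rep F 1,
    (xi sigma1 : 'M_1) = w%:M /\ (xi sigma2 : 'M_1) = w%:M.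
Proof.
move=> w0; pose W := MkGL (GL1_unit w0).
(* Both generators go to [W], so the braid relation reads [W * W * W = W * W * W]. *)
have [xi [e1 e2]] := @B3_lift_exists (GL F 1) W W erefl.
by exists xi; rewrite e1 e2.
Qed.

Lemma braid_mx (F : fieldType) (k : nat) (rho : B3_rep F k) :
  (rho sigma1 : 'M_k) *m rho sigma2 *m rho sigma1
    = (rho sigma2 : 'M_k) *m rho sigma1 *m rho sigma2.
Proof.
by have := congr1 (fun g => rho g : 'M_k) B3_relation; rewrite /= !gmulfM.
Qed.

(** [tau] is [rho] conjugated by [P^-1] and twisted by [w^-1]; undoing both operations recovers
    [rho]. Any rescaled change of basis thus realizes [S] and [T] as generator images. *)
Lemma twist_conj (F : fieldType) (k : nat) (rho : B3_rep F k)
    (P : 'M[F]_k) (w : F) (S T : 'M[F]_k) :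
  P \in unitmx -> w != 0 ->
  (rho sigma1 : 'M_k) *m P = w *: (P *m S) ->
  (rho sigma2 : 'M_k) *m P = w *: (P *m T) ->
  exists (xi : B3_rep F 1) (tau : B3_rep F k),
    [/\ rep_iso rho (tensor1 xi tau), (tau sigma1 : 'M_k) = S
      & (tau sigma2 : 'M_k) = T].
Proof.
move=> Pu w0 e1 e2; pose Q := MkGL Pu.
have [xi [xi1 xi2]] := rep1_exists w0.
have wV0 : w^-1 != 0 by rewrite invr_eq0.
have [xiV [xiV1 xiV2]] := rep1_exists wV0.
pose tau := tensor1 xiV (conj_rep Q^-1%g rho).
have PinvK X Y : X *m P = w *: (P *m Y) -> w^-1 *: (invmx P *m X *m P) = Y.
  by move=> e; rewrite -mulmxA e -scalemxAr scalerA mulVf // scale1r mulKmx.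
have t1 : (tau sigma1 : 'M_k) = S.
  by rewrite /= invmxK xiV1 !mxE eqxx mulr1n; apply: PinvK.
have t2 : (tau sigma2 : 'M_k) = T.
  by rewrite /= invmxK xiV2 !mxE eqxx mulr1n; apply: PinvK.
exists xi, tau; split=> //; apply: (@rep_iso_gen _ _ _ _ Q); apply: val_inj.
- change (val (rho sigma1) = P *m
    ((xi sigma1 : 'M_1) ord0 ord0 *: (tau sigma1 : 'M_k)) *m invmx P).
  by rewrite t1 xi1 mxE eqxx mulr1n -scalemxAr -e1 mulmxK.
- change (val (rho sigma2) = P *m
    ((xi sigma2 : 'M_1) ord0 ord0 *: (tau sigma2 : 'M_k)) *m invmx P).
  by rewrite t2 xi2 mxE eqxx mulr1n -scalemxAr -e2 mulmxK.
Qed.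

(** * Irreducibility expressed through common eigenvectors *)

Definition no_common_eigenvector (F : fieldType) (k : nat) (A B : 'M[F]_k) :=
  forall (u : 'cV_k) (x y : F),
    A *m u = x *: u -> B *m u = y *: u -> u = 0.

Lemma irreducible_no_common_eigenvector (F : fieldType) (k : nat)
    (rho : B3_rep F k) : (1 < k)%N ->
  rep_irreducible rho ->
  no_common_eigenvector (rho sigma1 : 'M_k) (rho sigma2 : 'M_k).
Proof.
move=> k1 [_ irr] u x y e1 e2; apply/eqP; apply: contraT => u0.
have eig g : exists c, (rho g : 'M_k) *m u = c *: u.
  elim/B3_ind: g => [|g h [c ec] [d ed]|g [c ec]||]; last 2 first.
  - by exists x.
  - by exists y.
  - by exists 1; rewrite multiplicative1 mul1mx scale1r.
  - by exists (d * c); rewrite gmulfM -mulmxA ed -scalemxAr ec scalerA.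
  - exists c^-1; rewrite multiplicativeV.
    (* The eigenvalue [c] is nonzero because [rho g] is invertible and [u] is nonzero. *)
    have {1}-> : u = c^-1 *: (c *: u).
      rewrite scalerA mulVf ?scale1r //; apply: contraNneq u0 => c0.
      by rewrite -(mulKmx (GLmxP (rho g)) u) ec c0 scale0r mulmx0.
    by rewrite -ec -scalemxAr mulKmx ?GLmxP.
(* Irreducibility is stated for square matrices, so the row [u^T] is replaced by a square matrix
   with the same row space; its rank is at most 1, below [k]. *)
have full : row_full (<<u^T>>%MS : 'M_k).
  apply: irr; last by rewrite -mxrank_eq0 genmxE mxrank_eq0 trmx_eq0.
  move=> g; have [c ec] := eig g.
  rewrite (eqmx_stable _ (genmxE _)) -trmx_mul ec linearZ /=.
  exact: scalemx_sub.
have := rank_leq_row u^T.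
by move: full; rewrite /row_full genmxE => /eqP ->; rewrite leqNgt k1.
Qed.

(** [P] carries a common eigenvector of [S] and [T] to one of [A] and [B], with eigenvalues
    multiplied by [w]. *)
Lemma no_common_eigenvector_conj (F : fieldType) (k : nat)
    (P A B S T : 'M[F]_k) (w : F) :
  P \in unitmx -> A *m P = w *: (P *m S) -> B *m P = w *: (P *m T) ->
  no_common_eigenvector A B -> no_common_eigenvector S T.
Proof.
move=> Pu eA eB nAB u x y eS eT; rewrite -(mulKmx Pu u).
rewrite (nAB (P *m u) (w * x) (w * y)) ?mulmx0 // mulmxA ?eA ?eB.
- by rewrite -scalemxAl -mulmxA eS -scalemxAr scalerA.
- by rewrite -scalemxAl -mulmxA eT -scalemxAr scalerA.
Qed.

(** * Explicit calculus of 2 x 2 matrices *)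

Section Matrices22.
Variable F : fieldType.
Implicit Types a b c d : F.

Lemma mx22_eta (A : 'M[F]_2) : exists a b c d, A = mx22 a b c d.
Proof.
exists (A 0 0), (A 0 1), (A 1 0), (A 1 1); apply/matrixP => i j; rewrite mxE.
case: (unliftP 0 i) => [i'|] ->; last first.
  by case: (unliftP 0 j) => [j'|] ->; rewrite //= (ord1 j'); congr (A _ _);
    apply: val_inj.
by case: (unliftP 0 j) => [j'|] ->; rewrite /= (ord1 i') ?(ord1 j');
  congr (A _ _); apply: val_inj.
Qed.

Lemma mulmx22 a b c d a' b' c' d' :
  mx22 a b c d *m mx22 a' b' c' d'
    = mx22 (a * a' + b * c') (a * b' + b * d')
           (c * a' + d * c') (c * b' + d * d').
Proof.
apply/matrixP => i j; rewrite !mxE !big_ord_recl big_ord0 !mxE addr0 /=.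
by case: ifP; case: ifP.
Qed.

Lemma scalemx22 x a b c d :
  x *: mx22 a b c d = mx22 (x * a) (x * b) (x * c) (x * d).
Proof. by apply/matrixP => i j; rewrite !mxE; case: ifP; case: ifP. Qed.

Lemma mx22_inj a b c d a' b' c' d' :
  mx22 a b c d = mx22 a' b' c' d' -> [/\ a = a', b = b', c = c' & d = d'].
Proof.
move=> /matrixP e.
by split; [move: (e 0 0)|move: (e 0 1)|move: (e 1 0)|move: (e 1 1)];
  rewrite !mxE.
Qed.

Lemma det_mx22 a b c d : \det (mx22 a b c d) = a * d - b * c.
Proof. rewrite (expand_det_row _ ord0) !big_ord_recl big_ord0 addr0 /cofactor.
by rewrite !det_mx11 !mxE /= expr0 expr1 mul1r mulN1r mulrN. Qed.

Lemma unitmx22 a b c d : (mx22 a b c d \in unitmx) = (a * d - b * c != 0).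
Proof. by rewrite unitmxE det_mx22 unitfE. Qed.

(** If both lower-left entries vanished, the first basis vector would be a common eigenvector. *)
Lemma no_common_eigenvector_lower a b c d a' b' c' d' :
  no_common_eigenvector (mx22 a b c d) (mx22 a' b' c' d') ->
  c = 0 -> c' != 0.
Proof.
move=> nAB c0; apply/negP => /eqP c'0.
have := nAB (delta_mx 0 0) a a'; rewrite c0 c'0.
have col0 x y z : mx22 x y 0 z *m delta_mx 0 0 = x *: (delta_mx 0 0 : 'cV_2).
  rewrite -colE; apply/colP => i; rewrite !mxE andbT /=.
  by case: ifP; rewrite ?mulr1 ?mulr0.
rewrite !col0 => /(_ erefl erefl) /matrixP /(_ 0 0) /eqP.
by rewrite !mxE oner_eq0.
Qed.

(** Here the second basis vector would be a common eigenvector. *)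
Lemma no_common_eigenvector_upper a b c d a' b' c' d' :
  no_common_eigenvector (mx22 a b c d) (mx22 a' b' c' d') ->
  b = 0 -> b' != 0.
Proof.
move=> nAB b0; apply/negP => /eqP b'0.
have := nAB (delta_mx 1 0) d d'; rewrite b0 b'0.
have col1 x y z : mx22 x 0 y z *m delta_mx 1 0 = z *: (delta_mx 1 0 : 'cV_2).
  rewrite -colE; apply/colP => i; rewrite !mxE andbT /=.
  by case: i => -[|[|//]] ?; rewrite /= ?mulr1 ?mulr0.
rewrite !col1 => /(_ erefl erefl) /matrixP /(_ 1 0) /eqP.
by rewrite !mxE oner_eq0.
Qed.

End Matrices22.

(** * Normal form of one invertible matrix up to conjugation and scaling *)

Lemma trigonalize22 (F : closedFieldType) (A : 'M[F]_2) :
  exists (P : 'M[F]_2) (a b d : F),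
    P \in unitmx /\ A *m P = P *m mx22 a b 0 d.
Proof.
have [a [b [c [d ->]]]] := mx22_eta A.
have [->|c0] := eqVneq c 0.
  by exists 1%:M, a, b, d; rewrite unitmx1 mulmx1 mul1mx.
(* [x] is a root of the characteristic polynomial [X^2 - (a + d) X + (a d - b c)]. *)
have [x] := @solve_monicpoly F 2 (nth 0 [:: b * c - a * d; a + d]) isT.
rewrite !big_ord_recl big_ord0 /= expr0 expr1 mulr1 addr0 => ex.
(* The first column [(x - d, c)] is an eigenvector for [x]; the first basis vector completes it to a
   basis since [c] is nonzero. The trace gives the other eigenvalue. *)
exists (mx22 (x - d) 1 c 0), x, 1, (a + d - x); split.
  by rewrite unitmx22 mulr0 mul1r sub0r oppr_eq0.
rewrite !mulmx22; congr (mx22 _ _ _ _); try ring.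
by ring: ex.
Qed.

Lemma normal_form22 (F : closedFieldType) (A : 'M[F]_2) : A \in unitmx ->
  exists (P : 'M[F]_2) (w z : F) (S : 'M[F]_2),
    [/\ P \in unitmx, w != 0, A *m P = w *: (P *m S)
      & [/\ S = mx22 (- z) 0 0 1, z != 0 & z != - 1] \/ S = mx22 1 z 0 1].
Proof.
move=> Au; have [P [a [b [d [Pu eA]]]]] := trigonalize22 A.
have : mx22 a b 0 d \in unitmx.
  by rewrite -(mulKmx Pu (mx22 _ _ _ _)) -eA !unitmx_mul unitmx_inv Pu Au.
rewrite unitmx22 mulr0 subr0 mulf_eq0 negb_or => /andP[a0 d0].
have [ad|ad] := eqVneq a d.
  exists P, d, (b / d), (mx22 1 (b / d) 0 1); split=> //; last by right.
  rewrite eA ad scalemxAr scalemx22; congr (_ *m mx22 _ _ _ _); by field.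
(* The column [(b, d - a)] is an eigenvector of the triangular matrix for [d], independent of the
   first basis vector since [a] differs from [d]. *)
exists (P *m mx22 1 b 0 (d - a)), d, (- (a / d)), (mx22 (a / d) 0 0 1).
split=> //.
- by rewrite unitmx_mul Pu unitmx22 mul1r mulr0 subr0 subr_eq0 eq_sym.
- rewrite mulmxA eA -!mulmxA scalemxAr; congr (_ *m _).
  by rewrite !mulmx22 scalemx22; congr mx22; field.
- left; split; first by rewrite opprK.
  + by rewrite oppr_eq0 mulf_neq0 ?invr_eq0.
  + rewrite eqr_opp; apply: contra_neq ad => e.
    by rewrite -[a](divfK d0) e mul1r.
Qed.

(** * Solving the braid relation for the second generator *)

Lemma braid_diagonal (F : fieldType) (z p q r s : F) :
  z != 0 -> z != - 1 -> q != 0 -> r != 0 ->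
  mx22 (- z) 0 0 1 *m mx22 p q r s *m mx22 (- z) 0 0 1
    = mx22 p q r s *m mx22 (- z) 0 0 1 *m mx22 p q r s ->
  [/\ p = 1 / (z + 1), s = - (z ^+ 2 / (z + 1)),
      q * r = z * (z ^+ 2 + z + 1) / (z + 1) ^+ 2 & z ^+ 2 + z + 1 != 0].
Proof.
move=> z0; rewrite -addr_eq0 => z1 q0 r0; rewrite !mulmx22.
have sub0 (x y : F) : x = y -> x - y = 0 by move->; rewrite subrr.
case/mx22_inj=> /sub0 e00 /sub0 e01 _ /sub0 e11.
have es : s = z * (p - 1).
  apply: (mulfI q0); apply: subr0_eq.
  by rewrite -[RHS]oppr0 -[X in _ = - X]e01; ring.
have eqr : q * r = z * p * (z + p).
  by apply: subr0_eq; rewrite -[RHS]oppr0 -[X in _ = - X]e00; ring.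
(* After elimination of [s] and [q r], the [p^2] terms of the lower-right entry cancel, leaving
   [z (z + 1) (p (z + 1) - 1) = 0]. *)
have ep : p = 1 / (z + 1).
  apply: (mulIf z1); rewrite divfK //; apply: (mulfI (mulf_neq0 z0 z1)).
  by apply: subr0_eq; rewrite -[RHS]e11 es; ring: eqr.
have eqr' : q * r = z * (z ^+ 2 + z + 1) / (z + 1) ^+ 2.
  by rewrite eqr ep; field.
split=> //; first by rewrite es ep; field.
apply: contra_neq (mulf_neq0 q0 r0) => e.
by rewrite eqr' e mulr0 mul0r.
Qed.

Lemma braid_unipotent (F : fieldType) (z p q r s : F) :
  r != 0 ->
  mx22 p q r s \in unitmx ->
  mx22 1 z 0 1 *m mx22 p q r s *m mx22 1 z 0 1
    = mx22 p q r s *m mx22 1 z 0 1 *m mx22 p q r s ->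
  [/\ z != 0, r = - (1 / z), q = z * (p - 1) ^+ 2 & s = 2 - p].
Proof.
move=> r0 Bu braid.
(* The unipotent factor has determinant 1, so the braid relation gives [det B = (det B)^2] for the
   invertible second matrix [B]. *)
have det1 : p * s - q * r = 1.
  rewrite unitmx22 in Bu; apply: (mulfI Bu).
  move/(congr1 determinant): braid.
  by rewrite !det_mulmx !det_mx22 !(mulr0, mulr1, mul1r, subr0).
move: braid; rewrite !mulmx22.
have sub0 (x y : F) : x = y -> x - y = 0 by move->; rewrite subrr.
case/mx22_inj=> _ _ /sub0 e10 /sub0 e11.
have esum : p + s = 1 - r * z.
  apply: (mulfI r0); apply: subr0_eq.
  by rewrite -[RHS]oppr0 -[X in _ = - X]e10; ring.
have eqr : q * r = p * s - 1 by rewrite -det1; ring.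
(* With [p] and [q r] substituted, the lower-right entry reduces to [r z + s = s - 1]. This also
   forces [z] to be nonzero, excluding a scalar first generator. *)
have erz : r * z = - 1.
  have ep : p = 1 - r * z - s by rewrite -esum addrK.
  by rewrite ep in eqr; apply: subr0_eq; rewrite -[RHS]e11; ring: eqr.
have z0 : z != 0.
  by apply: contra_eq_neq erz => ->; rewrite mulr0 eq_sym oppr_eq0 oner_neq0.
have es : s = 2 - p by rewrite -[s](addKr p) esum erz; ring.
split=> //; first by apply: (mulIf z0); rewrite erz mulNr divfK.
(* Trace 2 and determinant 1 give [q r = - (p - 1)^2], and [r z = - 1] turns this into the formula
   for [q]. *)
by apply: (mulIf r0); rewrite eqr es; ring: erz.
Qed.

Theorem theorem1 (R : realType) (rho : B3_rep R[i] 2) :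
  rep_irreducible rho ->
  exists (xi : B3_rep R[i] 1) (tau : B3_rep R[i] 2),
    rep_iso rho (tensor1 xi tau) /\ (form_i tau \/ form_ii tau).
Proof.
move=> irr.
have [P [w [z [S [Pu w0 e1 eS]]]]] := normal_form22 (GLmxP (rho sigma1)).
(* The second generator is taken in the same basis and divided by the same [w], as a 1-dimensional
   twist scales both generators equally. *)
pose T := w^-1 *: (invmx P *m rho sigma2 *m P).
have e2 : (rho sigma2 : 'M_2) *m P = w *: (P *m T).
  by rewrite /T -scalemxAr scalerA mulfV // scale1r -mulmxA mulKVmx.
have nST := no_common_eigenvector_conj Pu e1 e2
  (@irreducible_no_common_eigenvector _ 2 _ isT irr).
have [xi [tau [iso t1 t2]]] := twist_conj Pu w0 e1 e2.
exists xi, tau; split=> //.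
have braid := braid_mx tau; have Tu := GLmxP (tau sigma2).
rewrite t1 t2 in braid; rewrite t2 in Tu.
have [p [q [r [s eT]]]] := mx22_eta T.
rewrite {}eT in t2 nST braid Tu.
case: eS => [[eS z0 z1]|eS]; rewrite {}eS in t1 nST braid.
- left.
  have q0 := no_common_eigenvector_upper nST erefl.
  have r0 := no_common_eigenvector_lower nST erefl.
  have [ep es eqr nz] := braid_diagonal z0 z1 q0 r0 braid.
  by exists z, q, r; split; rewrite // t2 ep es.
- right.
  have r0 := no_common_eigenvector_lower nST erefl.
  have [z0 er eq es] := braid_unipotent r0 Tu braid.
  by exists z, p; split; rewrite // t2 er eq es.
Qed.
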